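(* There is a universal constant $\kappa>0$ such that the following holds. Let $p\ge 2$ and let $(X,\|\cdot\|)$ be a Banach space for which there exists $K>0$ such that $$\forall x,y\in X,\quad \left\|\frac{x+y}{2}\right\|^p\le \frac{\|x\|^p+\|y\|^p}{2}-\frac{1}{K^p}\left\|\frac{x-y}{2}\right\|^p.$$ Then for every $R\ge 4$ we have $$c_X(B_R)\ge \frac{\kappa}{K_p(X)}\left(\frac{\log R}{\log\log R}\right)^{1/p}.$$
   Context: $\mathbb{H}=\langle a,b \mid aba^{-1}b^{-1}\text{ is central}\rangle$ is the discrete Heisenberg group with identity $e$, and $d_W$ is the left-invariant word metric on $\mathbb{H}$ associated to the symmetric generating set $S=\{a,b,a^{-1},b^{-1}\}$. For $R\ge1$, $B_R=\{x\in\mathbb{H}: d_W(e,x)\le R\}$. $K_p(X)$ denotes the infimum over those $K>0$ for which the displayed convexity inequality in the claim holds for all $x,y\in X$. The bi-Lipschitz distortion $c_X(B_R)$ of $(B_R,d_W)$ in $(X,\|\cdot\|)$ is the infimum over those $D\ge1$ such that there exists $f:B_R\to X$ satisfying $d_W(x,y)\le\|f(x)-f(y)\|\le D\,d_W(x,y)$ for all $x,y\in B_R$ (and is $\infty$ if there is no such $D$). *)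

(* Defs.v *)
From HB Require Import structures.
From mathcomp Require Import all_boot all_order all_algebra.
From mathcomp Require Import generic_quotient.
From mathcomp Require Import all_classical all_reals all_analysis.
Import Order.TTheory GRing.Theory Num.Theory.
Import numFieldNormedType.Exports.

Set Implicit Arguments.
Unset Strict Implicit.
Unset Printing Implicit Defensive.

Local Open Scope classical_set_scope.
Local Open Scope ring_scope.

(* A letter (g, e) is the generator a (g = false) or b (g = true), inverted
   when e = true. *)
Definition letter : Type := (bool * bool)%type.
Definition letter_inv (l : letter) : letter := (l.1, ~~ l.2).
Definition word : Type := seq letter.
Definition word_inv (w : word) : word := rev (map letter_inv w).

(* The word a b a^-1 b^-1. *)
Definition comm_word : word :=
  [:: (false, false); (true, false); (false, true); (true, true)].

(* The least congruence on words that cancels inverse letters and makes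
   comm_word commute with every word: the quotient of words by it is the group
   presented by < a, b | a b a^-1 b^-1 is central >. *)
Inductive heis_rel : word -> word -> Prop :=
| heis_refl u : heis_rel u u
| heis_sym u v : heis_rel u v -> heis_rel v u
| heis_trans u v w : heis_rel u v -> heis_rel v w -> heis_rel u w
| heis_cat u u' v v' :
    heis_rel u u' -> heis_rel v v' -> heis_rel (u ++ v) (u' ++ v')
| heis_cancel l : heis_rel [:: l; letter_inv l] [::]
| heis_central w : heis_rel (comm_word ++ w) (w ++ comm_word).

Definition heis_eqv : rel word := fun u v => `[< heis_rel u v >].

Lemma heis_eqv_refl : reflexive heis_eqv.
Proof. by move=> u; apply/asboolP; exact: heis_refl. Qed.

Lemma heis_eqv_sym : symmetric heis_eqv.
Proof. by move=> u v; apply/asboolP/asboolP; exact: heis_sym. Qed.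

Lemma heis_eqv_trans : transitive heis_eqv.
Proof.
by move=> v u w /asboolP uv /asboolP vw; apply/asboolP; exact: heis_trans vw.
Qed.

Canonical heis_eqv_equiv :=
  EquivRel heis_eqv heis_eqv_refl heis_eqv_sym heis_eqv_trans.

Local Open Scope quotient_scope.

Definition heis : Type := {eq_quot heis_eqv}.
HB.instance Definition _ := Choice.on heis.
HB.instance Definition _ := Quotient.on heis.
HB.instance Definition _ := EqQuotient.on heis.

Lemma heis_piP (u v : word) : (\pi_heis u = \pi_heis v) <-> heis_rel u v.
Proof.
split=> [/eqP|uv]; first by rewrite pi_eq_quot => /asboolP.
by apply/eqP; rewrite pi_eq_quot; apply/asboolP.
Qed.

Lemma letter_invK : involutive letter_inv.
Proof. by case=> g e; rewrite /letter_inv /= negbK. Qed.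

Lemma word_invK : involutive word_inv.
Proof.
by move=> w; rewrite /word_inv map_rev revK -map_comp map_id_in // => l _;
   rewrite /= letter_invK.
Qed.

Lemma word_mulV (w : word) : heis_rel (w ++ word_inv w) [::].
Proof.
elim: w => [|l w IH]; first exact: heis_refl.
rewrite /word_inv /= rev_cons -cats1 -cat1s.
rewrite -/(word_inv w) -[_ ++ _ ++ _]/([:: l] ++ (w ++ (word_inv w ++ _))).
rewrite (catA w); apply: heis_trans (heis_cancel l).
rewrite -[[:: l; letter_inv l]]/([:: l] ++ ([::] ++ [:: letter_inv l])).
by apply: heis_cat (heis_refl _) _; apply: heis_cat IH (heis_refl _).
Qed.

Lemma word_mulV' (w : word) : heis_rel (word_inv w ++ w) [::].
Proof. by rewrite -{2}[w]word_invK; exact: word_mulV. Qed.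

Lemma word_inv_rel (u v : word) :
  heis_rel u v -> heis_rel (word_inv u) (word_inv v).
Proof.
move=> uv; apply: (@heis_trans _ (word_inv u ++ v ++ word_inv v)).
  rewrite -{1}[word_inv u]cats0.
  by apply: heis_cat (heis_refl _) _; apply/heis_sym/word_mulV.
rewrite catA -{2}[word_inv v]cat0s; apply: heis_cat (heis_refl _).
apply: heis_trans (word_mulV' u).
by apply: heis_cat (heis_refl _) _; exact: heis_sym.
Qed.

Definition heis_one : heis := \pi_heis [::].
Definition heis_mul (x y : heis) : heis := \pi_heis (repr x ++ repr y).
Definition heis_inv (x : heis) : heis := \pi_heis (word_inv (repr x)).

Lemma repr_heis (w : word) : heis_rel (repr (\pi_heis w)) w.
Proof. by apply/heis_piP; rewrite reprK. Qed.

Lemma heis_mul_pi (u v : word) :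
  heis_mul (\pi_heis u) (\pi_heis v) = \pi_heis (u ++ v).
Proof. by apply/heis_piP; apply: heis_cat; exact: repr_heis. Qed.

Lemma heis_inv_pi (u : word) :
  heis_inv (\pi_heis u) = \pi_heis (word_inv u).
Proof. by apply/heis_piP/word_inv_rel/repr_heis. Qed.

Lemma heis_mulA : associative heis_mul.
Proof.
move=> x y z; rewrite -[x]reprK -[y]reprK -[z]reprK.
rewrite (heis_mul_pi (repr y)) (heis_mul_pi (repr x) (repr y)).
by rewrite (heis_mul_pi (repr x)) heis_mul_pi catA.
Qed.

Lemma heis_mul1 : left_id heis_one heis_mul.
Proof. by move=> x; rewrite -[x]reprK heis_mul_pi. Qed.

Lemma heis_mulr1 : right_id heis_one heis_mul.
Proof. by move=> x; rewrite -[x]reprK heis_mul_pi cats0. Qed.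

Lemma heis_mulVl : left_inverse heis_one heis_inv heis_mul.
Proof.
by move=> x; rewrite -[x]reprK heis_inv_pi heis_mul_pi; apply/heis_piP/word_mulV'.
Qed.

Lemma heis_mulVr : right_inverse heis_one heis_inv heis_mul.
Proof.
by move=> x; rewrite -[x]reprK heis_inv_pi heis_mul_pi; apply/heis_piP/word_mulV.
Qed.

HB.instance Definition _ := isGroup.Build heis
  heis_mulA heis_mul1 heis_mulr1 heis_mulVl heis_mulVr.

Definition heis_a : heis := \pi_heis [:: (false, false)].
Definition heis_b : heis := \pi_heis [:: (true, false)].
Definition heis_gens : seq heis :=
  [:: heis_a; heis_b; heis_a^-1%g; heis_b^-1%g].

Definition generating (G : groupType) (S : seq G) : Prop :=
  forall g : G, exists2 s : seq G,
    {subset s <= S} & (\prod_(h <- s) h)%g = g.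

Lemma heis_gens_generating : generating heis_gens.
Proof.
elim/quotW; elim=> [|l w [s sS sw]].
  by exists [::] => //; rewrite big_nil.
exists (\pi_heis [:: l] :: s); last first.
  by rewrite big_cons sw; exact: heis_mul_pi.
move=> x; rewrite in_cons => /predU1P[->|/sS//].
rewrite /heis_gens !inE /heis_a /heis_b.
have -> : (\pi_heis [:: (false, false)])^-1%g = \pi_heis [:: (false, true)].
  exact: heis_inv_pi.
have -> : (\pi_heis [:: (true, false)])^-1%g = \pi_heis [:: (true, true)].
  exact: heis_inv_pi.
by case: l => [[] []]; rewrite eqxx ?orbT.
Qed.

Lemma word_length_subproof (G : groupType) (S : seq G) (HS : generating S)
    (g : G) :
  exists n, `[< exists s : seq G,
    [/\ size s = n, {subset s <= S} & (\prod_(h <- s) h)%g = g] >].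
Proof. by have [s sS sg] := HS g; exists (size s); apply/asboolP; exists s. Qed.

Definition word_length (G : groupType) (S : seq G) (HS : generating S)
    (g : G) : nat :=
  ex_minn (word_length_subproof HS g).

Definition word_dist (G : groupType) (S : seq G) (HS : generating S)
    (x y : G) : nat :=
  word_length HS (x^-1 * y)%g.

Definition dW (x y : heis) : nat := word_dist heis_gens_generating x y.

Definition heis_ball (R : realType) (r : R) : set heis :=
  [set x | (dW 1%g x)%:R <= r].

Definition convexity_ineq (R : realType) (p : R) (X : normedModType R)
    (K : R) : Prop :=
  forall x y : X,
    `|2^-1 *: (x + y)| `^ p <=
      (`|x| `^ p + `|y| `^ p) / 2 - (K `^ p)^-1 * `|2^-1 *: (x - y)| `^ p.

(* Extended-real valued, so that K_p = 0 (which happens only for X = {0}) is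
   inverted to +oo. *)
Definition convexity_constant (R : realType) (p : R) (X : normedModType R) :
    \bar R :=
  ereal_inf [set K%:E | K in [set K : R | 0 < K /\ convexity_ineq p X K]].

(* Only the restriction of f to A matters; the value is +oo when there is no
   bi-Lipschitz embedding. *)
Definition distortion (R : realType) (T : Type) (d : T -> T -> R) (A : set T)
    (X : normedModType R) : \bar R :=
  ereal_inf [set D%:E | D in [set D : R | 1 <= D /\
    exists f : T -> X, forall x y, A x -> A y ->
      d x y <= `|f x - f y| <= D * d x y]].

(* Main.v *)
Require Import Defs.
From HB Require Import structures.
From mathcomp Require Import all_boot all_order all_algebra.
From mathcomp Require Import all_classical all_reals all_analysis.
From mathcomp Require Import zify ring lra.
Import Order.TTheory GRing.Theory Num.Theory.
Import numFieldNormedType.Exports.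

(** Let f be a D-Lipschitz map on the ball that does not contract distances,
    and let c be the central commutator of a and b.  The slope of f at x over
    the length n in the direction a is (f(x a^n) - f(x)) / n, and similarly
    for b.

    Uniform convexity makes slopes stabilise.  The slope over the length n M
    is the mean of M consecutive slopes over the length n, so passing from n
    to n M lowers the mean p-th power of the norm of the slope by at least
    (2K)^(-p) times the mean p-th power of the deviation of the short slopes
    from the long one ([variance_dyadic], [defect_le]).  These p-th powers
    stay between 0 and D^p, so out of J scales n = 1, M, M^2, ... there is one
    at which the mean p-th deviation, for a and for b, is O((2KD)^p / J)
    ([good_scale]).  The means are taken over a box that is almost invariant
    under the translations involved ([box_sum_shift]).

    The group geometry prevents slopes from stabilising too well.  Walk from x
    along a^n, b^n, a^-n, b^-n: the walk ends at x c^(n^2), at distance at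
    least n from x, so f moves by at least n, while this displacement is n
    times the difference of the slopes on the two a-edges plus n times the
    difference of the slopes on the two b-edges.  Put parallel edges inside
    segments of length n M: these segments stay at distance O(n sqrt M) of
    each other, so the long slopes differ by O(D / sqrt M) only.  If sqrt M is
    a large multiple of D, the short slopes have to deviate from the long ones
    by a fixed amount ([commutator_slopes]).

    Comparing the two facts gives J <= 12 (16 K D)^p ([scale_count]).  The
    scales have ratio M = O(D^2), and D may be taken at most log R, so the
    ball has room for J of order log R / log log R of them ([scales_fit]). *)

Set Implicit Arguments.
Unset Strict Implicit.
Unset Printing Implicit Defensive.

Local Open Scope classical_set_scope.
Local Open Scope ring_scope.

(** * Word lengths *)

Section WordLength.
Variables (G : groupType) (S : seq G) (HS : generating S).
Local Open Scope nat_scope.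
Local Open Scope group_scope.

Lemma word_length_le (s : seq G) :
  {subset s <= S} -> word_length HS (\prod_(h <- s) h) <= size s.
Proof.
move=> sS; rewrite /word_length; case: ex_minnP => m _; apply.
by apply/asboolP; exists s.
Qed.

Lemma word_lengthP (g : G) :
  exists s : seq G,
    [/\ size s = word_length HS g, {subset s <= S} & \prod_(h <- s) h = g].
Proof. by rewrite /word_length; case: ex_minnP => m /asboolP. Qed.

Lemma word_lengthM (g h : G) :
  word_length HS (g * h) <= word_length HS g + word_length HS h.
Proof.
have [s [<- sS sg]] := word_lengthP g.
have [t [<- tS th]] := word_lengthP h.
rewrite -sg -th -big_cat -size_cat; apply: word_length_le => x.
by rewrite mem_cat => /orP[/sS|/tS].
Qed.

Lemma word_lengthM_le (g h : G) (m n : nat) :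
  word_length HS g <= m -> word_length HS h <= n ->
  word_length HS (g * h) <= (m + n)%N.
Proof. by move=> gm hn; rewrite (leq_trans (word_lengthM g h))// leq_add. Qed.

Lemma word_lengthX (g : G) (n : nat) :
  g \in S -> word_length HS (g ^+ n) <= n.
Proof.
move=> gS; have -> : g ^+ n = \prod_(h <- nseq n g) h.
  by rewrite big_nseq iter_mulg_1.
rewrite -[leqRHS](size_nseq n g); apply: word_length_le => x.
by rewrite mem_nseq => /andP[_ /eqP->].
Qed.

Lemma word_lengthV_le (g : G) : {in S, forall h, h^-1 \in S} ->
  word_length HS g^-1 <= word_length HS g.
Proof.
move=> SV; have [s [<- sS <-]] := word_lengthP g.
rewrite -{1}(revK s) -prodgV -(size_rev s) -(size_map (fun h : G => h^-1)).
rewrite -(big_map _ xpredT id).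
apply: word_length_le => x /mapP[y]; rewrite mem_rev => /sS yS ->.
exact: SV.
Qed.

Hypothesis SV : {in S, forall h, h^-1 \in S}.

Lemma word_lengthV (g : G) : word_length HS g^-1 = word_length HS g.
Proof.
by apply/eqP; rewrite eqn_leq word_lengthV_le//= -{1}[g]invgK word_lengthV_le.
Qed.

End WordLength.

(** * The Heisenberg group *)

Section Heis.
Local Open Scope group_scope.

Definition heis_c : heis := \pi_heis%qT comm_word.

Lemma heis_cE : heis_c = heis_a * heis_b * heis_a^-1 * heis_b^-1.
Proof.
rewrite /heis_c /heis_a /heis_b.
rewrite -![(\pi_heis%qT _)^-1]/(heis_inv _) !heis_inv_pi.
by rewrite -![(_ * _)]/(heis_mul _ _) !heis_mul_pi.
Qed.

Lemma heis_c_central (x : heis) : commute heis_c x.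
Proof.
rewrite /commute /heis_c -[x]reprK.
rewrite -![(_ * _)]/(heis_mul _ _) !heis_mul_pi.
by apply/heis_piP; exact: heis_central.
Qed.

Lemma heis_cXC (n : nat) (x : heis) : x * heis_c ^+ n = heis_c ^+ n * x.
Proof. exact/commuteX/commute_sym/heis_c_central. Qed.

Lemma heis_abC : heis_a * heis_b = heis_b * heis_a * heis_c.
Proof.
by rewrite -heis_c_central heis_cE -!mulgA (mulgA heis_b^-1) mulVg mul1g mulVg mulg1.
Qed.

Lemma heis_aXbC (u : nat) :
  heis_a ^+ u * heis_b = heis_b * heis_a ^+ u * heis_c ^+ u.
Proof.
elim: u => [|u IH]; first by rewrite !expg0 mulg1 mul1g mulg1.
rewrite !expgS -mulgA IH !mulgA heis_abC -!mulgA; congr (_ * (_ * _)).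
by rewrite !mulgA heis_c_central.
Qed.

(** Moving a past b creates one c, so that moving a^u past b^v creates u v of
    them: this is why c^(n^2) has length O(n). *)
Lemma heis_aXbXC (u v : nat) :
  heis_a ^+ u * heis_b ^+ v = heis_b ^+ v * heis_a ^+ u * heis_c ^+ (u * v).
Proof.
elim: v => [|v IH]; first by rewrite !expg0 muln0 mulg1 mul1g mulg1.
rewrite [heis_b ^+ v.+1]expgSr mulgA IH mulnS expgnDr -!mulgA; congr (_ * _).
by rewrite -(heis_cXC _ heis_b) !mulgA heis_aXbC -!mulgA.
Qed.

(** In these coordinates right multiplication by a power of a or b is
    polynomial and never decreases a coordinate ([heis_pt_a], [heis_pt_b]), so
    natural numbers suffice. *)
Definition heis_pt (u v w : nat) : heis :=
  heis_b ^+ v * heis_a ^+ u * heis_c ^+ w.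

Lemma heis_pt_a (u v w t : nat) :
  heis_pt (u + t) v w = heis_pt u v w * heis_a ^+ t.
Proof.
by rewrite /heis_pt -!mulgA -(heis_cXC _ (heis_a ^+ t)) (mulgA (heis_a ^+ u)) expgnDr.
Qed.

Lemma heis_pt_b (u v w t : nat) :
  heis_pt u (v + t) (w + u * t) = heis_pt u v w * heis_b ^+ t.
Proof.
rewrite /heis_pt -!mulgA -(heis_cXC _ (heis_b ^+ t)) expgnDr -!mulgA.
congr (_ * _); rewrite [in RHS]mulgA heis_aXbXC -!mulgA -expgnDr.
by rewrite addnC.
Qed.

Lemma heis_pt_c (u v w t : nat) :
  heis_pt u v (w + t) = heis_pt u v w * heis_c ^+ t.
Proof. by rewrite /heis_pt expgnDr !mulgA. Qed.

End Heis.

Section HeisDist.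
Local Open Scope nat_scope.
Local Open Scope group_scope.

Local Notation wl := (word_length heis_gens_generating).

Lemma heis_gensV : {in heis_gens, forall h, h^-1 \in heis_gens}.
Proof.
by move=> h; rewrite !inE => /or4P[] /eqP->; rewrite ?invgK ?eqxx ?orbT//.
Qed.

Lemma dW_mul (x g : heis) : dW x (x * g) = wl g.
Proof. by rewrite /dW /word_dist mulKg. Qed.

Lemma word_length_aX (n : nat) : wl (heis_a ^+ n) <= n.
Proof. by apply: word_lengthX; rewrite !inE eqxx. Qed.

Lemma word_length_bX (n : nat) : wl (heis_b ^+ n) <= n.
Proof. by apply: word_lengthX; rewrite !inE eqxx orbT. Qed.

Lemma word_length_cXM (i j : nat) : wl (heis_c ^+ (i * j)) <= (2 * i + 2 * j)%N.
Proof.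
have -> : heis_c ^+ (i * j) =
    (heis_a ^- i * heis_b ^- j) * (heis_a ^+ i * heis_b ^+ j).
  by rewrite heis_aXbXC -invgM mulKg.
have -> : (2 * i + 2 * j = (i + j) + (i + j))%N by ring.
apply: word_lengthM_le; apply: word_lengthM_le;
  by rewrite ?(word_lengthV _ heis_gensV) ?word_length_aX ?word_length_bX.
Qed.

(** Division of r by m writes c^(n^2 r) as a product of two commutators whose
    sides have length at most n m. *)
Lemma word_length_cX (n m r : nat) : 0 < m -> r <= (m ^ 2)%N ->
  wl (heis_c ^+ (n ^ 2 * r)%N) <= (8 * n * m)%N.
Proof.
move=> m0 rm; rewrite (divn_eq r m).
have rE : (n ^ 2 * (r %/ m * m + r %% m) =
    (n * (r %/ m)) * (n * m) + (n * (r %% m)) * n)%N by rewrite -mulnn; ring.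
rewrite rE expgnDr.
have h3 : r %/ m <= m by rewrite -[leqRHS](mulnK m m0) leq_div2r// mulnn.
have h4 : r %% m < m by rewrite ltn_mod.
have h5 : (n * (r %/ m) <= n * m)%N by rewrite leq_mul2l h3 orbT.
have h6 : (n * (r %% m) + n <= n * m)%N by rewrite addnC -mulnS leq_mul2l h4 orbT.
have -> : (8 * n * m = 4 * (n * m) + 4 * (n * m))%N by ring.
apply: word_lengthM_le; (apply: leq_trans; first exact: word_length_cXM); lia.
Qed.

End HeisDist.

(** * Horizontal words enclose little area *)

Section Action.
Local Open Scope int_scope.

(** Words act on the integer Heisenberg group by right multiplication; the
    third coordinate is the area swept by the word, and c shifts it by 1. *)
Definition letter_act (s : int * int * int) (l : letter) : int * int * int :=
  let: (u, v, w) := s in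
  let e : int := if l.2 then -1 else 1 in
  if l.1 then (u, v + e, w + u * e) else (u + e, v, w).

Definition word_act (s : int * int * int) (w : word) := foldl letter_act s w.

Lemma word_act_comm (s : int * int * int) :
  word_act s comm_word = (s.1.1, s.1.2, s.2 + 1).
Proof.
by case: s => [[u v] w]; rewrite /=; congr (_, _, _); ring.
Qed.

Lemma word_act_central (q : int) (s : int * int * int) (w : word) :
  word_act (s.1.1, s.1.2, s.2 + q) w =
  ((word_act s w).1.1, (word_act s w).1.2, (word_act s w).2 + q).
Proof.
elim: w s => [|[g e] w IH] [[u v] z] //=.
by case: g => /=; rewrite -IH//=; congr word_act; congr (_, _, _); ring.
Qed.

Lemma word_act_rel (u v : word) : heis_rel u v ->
  forall s, word_act s u = word_act s v.
Proof.
elim=> {u v} [//|u v _ IH s|u v w _ IH1 _ IH2 s|u u' v v' _ IH1 _ IH2 s|l s|w s].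
- by rewrite IH.
- by rewrite IH1.
- by rewrite /word_act !foldl_cat -!/(word_act _ _) IH1 IH2.
- by case: s l => [[u v] w] [[] []] /=; congr (_, _, _); ring.
- rewrite /word_act !foldl_cat -!/(word_act _ _) !word_act_comm.
  by rewrite word_act_central.
Qed.

Definition heis_act (s : int * int * int) (x : heis) := word_act s (repr x).

Lemma heis_act_pi s (w : word) : heis_act s (\pi_heis%qT w) = word_act s w.
Proof. exact/word_act_rel/repr_heis. Qed.

Lemma heis_actM s (x y : heis) :
  heis_act s (x * y)%g = heis_act (heis_act s x) y.
Proof.
rewrite -[x]reprK -[y]reprK -![(_ * _)%g]/(heis_mul _ _) heis_mul_pi.
by rewrite !heis_act_pi /word_act foldl_cat.
Qed.

Lemma heis_act_cX s (n : nat) :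
  heis_act s (heis_c ^+ n)%g = (s.1.1, s.1.2, s.2 + n%:Z).
Proof.
elim: n s => [|n IH] [[u v] w].
  by rewrite -[(_ ^+ 0)%g]/(\pi_heis%qT [::]) heis_act_pi/= addr0.
rewrite expgS heis_actM heis_act_pi word_act_comm IH/=.
by congr (_, _, _); rewrite -addrA -intS.
Qed.

(** Each letter changes the area by at most the current width, which is at most
    the number of letters read so far. *)
Lemma heis_act_prod_bound (s : seq heis) : {subset s <= heis_gens} ->
  let: (u, v, w) := heis_act (0, 0, 0) (\prod_(h <- s) h)%g in
  `|u| <= (size s)%:Z /\ `|w| <= ((size s) ^ 2)%N%:Z.
Proof.
elim/last_ind: s => [_|s g IH sg].
  by rewrite big_nil -[1%g]/(\pi_heis%qT [::]) heis_act_pi.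
have /IH : {subset s <= heis_gens}.
  by move=> x xs; apply: sg; rewrite mem_rcons inE xs orbT.
have : g \in heis_gens by apply: sg; rewrite mem_rcons inE eqxx.
rewrite -cats1 big_cat big_seq1 /= heis_actM size_cat /= addn1.
case: (heis_act _ _) => [[u v] w] /= gS [hu hw].
have : [\/ heis_act (u, v, w) g = (u + 1, v, w),
  heis_act (u, v, w) g = (u - 1, v, w),
  heis_act (u, v, w) g = (u, v + 1, w + u) |
  heis_act (u, v, w) g = (u, v - 1, w - u)].
  move: gS; rewrite !inE => /or4P[] /eqP->.
  - by constructor 1; rewrite heis_act_pi.
  - by constructor 3; rewrite heis_act_pi/= mulr1.
  - by constructor 2; rewrite -[(_^-1)%g]/(heis_inv _) heis_inv_pi heis_act_pi.
  - constructor 4; rewrite -[(_^-1)%g]/(heis_inv _) heis_inv_pi heis_act_pi/=.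
    by rewrite mulrN1.
by case=> ->; lia.
Qed.

Lemma dW_cX_ge (x : heis) (n : nat) : (n <= dW x (x * heis_c ^+ (n ^ 2)%N)%g)%N.
Proof.
rewrite dW_mul.
have [s [<- sS sE]] := word_lengthP heis_gens_generating (heis_c ^+ (n ^ 2)%N)%g.
have := heis_act_prod_bound sS; rewrite sE heis_act_cX /= => -[_ h].
rewrite -leq_sqr; lia.
Qed.

End Action.

(** * Uniform convexity *)

Section UniformConvexity.
Variables (R : realType) (p : R) (X : normedModType R) (K : R).
Hypotheses (K0 : 0 < K) (cvx : convexity_ineq p X K).

Lemma midpoint_powR (x y : X) :
  `|2^-1 *: (x + y)| `^ p <= (`|x| `^ p + `|y| `^ p) / 2.
Proof.
apply: le_trans (cvx x y) _; rewrite gerBl mulr_ge0 ?powR_ge0//.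
by rewrite invr_ge0 powR_ge0.
Qed.

(** The midpoint inequality iterates along a binary tree, whence the power of
    two. *)
Lemma jensen_dyadic (k : nat) (Z : nat -> X) :
  `|(2 ^ k)%:R^-1 *: \sum_(i < 2 ^ k) Z i| `^ p <=
  (2 ^ k)%:R^-1 * \sum_(i < 2 ^ k) `|Z i| `^ p.
Proof.
elim: k Z => [|k IH] Z.
  by rewrite expn0 !big_ord1 invr1 scale1r mul1r.
have -> : (2 ^ k.+1 = 2 ^ k + 2 ^ k)%N by rewrite expnS mul2n addnn.
rewrite !big_split_ord /= natrD.
have e : ((2 ^ k)%:R + (2 ^ k)%:R : R)^-1 = 2^-1 * (2 ^ k)%:R^-1.
  by rewrite -invfM mulr_natl mulr2n.
rewrite e -scalerA scalerDr; apply: le_trans (midpoint_powR _ _) _.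
rewrite -mulrA mulrDr [leLHS]mulrC ler_wpM2l ?invr_ge0//.
by apply: lerD; [exact: (IH Z)|exact: (IH (fun i => Z (2 ^ k + i)%N))].
Qed.

(** Apply the convexity inequality to each Z i and the mean m, and average.
    The mean of the midpoints (Z i + m) / 2 is again m, so by Jensen
    the averaged inequality has at least the p-th power of the norm of m on
    its smaller side. *)
Lemma variance_dyadic (k : nat) (Z : nat -> X) (m : X) :
  m = (2 ^ k)%:R^-1 *: \sum_(i < 2 ^ k) Z i ->
  \sum_(i < 2 ^ k) `|Z i - m| `^ p <=
  (2 * K) `^ p * (\sum_(i < 2 ^ k) `|Z i| `^ p - (2 ^ k)%:R * `|m| `^ p).
Proof.
move=> mE; set S := \sum_(i < 2 ^ k) `|Z i| `^ p.
set D := \sum_(i < 2 ^ k) `|Z i - m| `^ p.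
set q : R := (2 ^ k)%:R.
have q0 : 0 < q by rewrite ltr0n expn_gt0.
have := jensen_dyadic k (fun i => 2^-1 *: (Z i + m)).
have -> : q^-1 *: \sum_(i < 2 ^ k) (2^-1 *: (Z i + m)) = m.
  rewrite -scaler_sumr big_split /= sumr_const card_ord -[m *+ _]scaler_nat -/q.
  rewrite scalerA mulrC -scalerA scalerDr -mE scalerA mulVf ?gt_eqF// scale1r.
  by rewrite -mulr2n -[m *+ 2]scaler_nat scalerA mulVf// scale1r.
move=> h1.
have h2 : \sum_(i < 2 ^ k) `|2^-1 *: (Z i + m)| `^ p <=
    (S + q * `|m| `^ p) / 2 - ((2 * K) `^ p)^-1 * D.
  apply: le_trans.
    by apply: ler_sum => i _; exact: cvx.
  rewrite sumrB -mulr_suml big_split /= sumr_const card_ord -[_ *+ _]mulr_natl -/q.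
  rewrite -mulr_sumr; apply: lerB => //; rewrite (@powRM _ 2)// ?(ltW K0)//.
  rewrite invfM -mulrA mulrCA ler_wpM2l ?invr_ge0 ?powR_ge0//.
  rewrite mulr_sumr; apply: ler_sum => i _.
  rewrite normrZ powRM// ger0_norm ?invr_ge0// -(@powR_inv1 _ 2)//.
  by rewrite powRAC powR_inv1 ?powR_ge0.
have h3 : `|m| `^ p * q <= (S + q * `|m| `^ p) / 2 - ((2 * K) `^ p)^-1 * D.
  by apply: le_trans h2; rewrite -ler_pdivlMr// mulrC.
have h4 : 0 < (2 * K) `^ p by apply: powR_gt0; rewrite mulr_gt0.
have D0 : 0 <= D by apply: sumr_ge0 => i _; rewrite powR_ge0.
rewrite -ler_pdivrMl//.
have : 0 <= ((2 * K) `^ p)^-1 * D by rewrite mulr_ge0// invr_ge0 ltW.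
lra.
Qed.

End UniformConvexity.

(** * Averaging over boxes *)

(** The triple (u, v, w) stands for b^v a^u c^w. *)
Definition point : Type := (nat * nat * nat)%type.

(** Right multiplication by b^t a^s c^r. *)
Definition shift (s t r : nat) (x : point) : point :=
  (x.1.1 + s, x.1.2 + t, x.2 + x.1.1 * t + r)%N.

(** The third side of the box is quadratic because right multiplication by b^t
    moves the third coordinate by u t, which is small compared with Q ^ 2 as
    soon as t is small compared with Q. *)
Definition box_sum (R : realType) (Q : nat) (phi : point -> R) : R :=
  \sum_(u < Q) \sum_(v < Q) \sum_(w < Q ^ 2)
    phi (nat_of_ord u, nat_of_ord v, nat_of_ord w).

(** The collar contains all translates of the box by shifts with s, t <= T and
    r <= 2 * T ^ 2. *)
Definition collar (Q T : nat) (x : point) : bool :=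
  [&& x.1.1 < Q + T, x.1.2 < Q + T & x.2 < Q ^ 2 + Q * T + 2 * T ^ 2]%N.

Section BoxSum.
Variable R : realType.

Lemma interval_shift (Q t : nat) (B : R) (phi : nat -> R) :
  (forall i, (i < Q + t)%N -> 0 <= phi i <= B) ->
  \sum_(i < Q) phi (i + t)%N <= \sum_(i < Q) phi i + t%:R * B.
Proof.
move=> hphi.
have -> : \sum_(i < Q) phi (i + t)%N = \sum_(i < Q) phi (rshift t i).
  by apply: eq_bigr => i _; rewrite /= addnC.
have : \sum_(i < t + Q) phi i = \sum_(i < Q + t) phi i.
  by rewrite addnC.
rewrite !big_split_ord /= => e.
have h0 : 0 <= \sum_(i < t) phi (lshift Q i).
  apply: sumr_ge0 => i _; apply: (proj1 (andP (hphi _ _))) => /=.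
  by have := ltn_ord i; lia.
have h1 : \sum_(i < t) phi (rshift Q i) <= t%:R * B.
  rewrite -[t in t%:R]card_ord mulr_natl -sumr_const; apply: ler_sum => i _.
  by apply: (proj2 (andP (hphi _ _))) => /=; rewrite ltn_add2l.
move: h0 h1 e => /=; lra.
Qed.

Lemma box_sum_le (Q : nat) (phi psi : point -> R) :
  (forall x, collar Q 0 x -> phi x <= psi x) ->
  box_sum Q phi <= box_sum Q psi.
Proof.
move=> h; do 3 (apply: ler_sum => ? _).
by apply: h; rewrite /collar/= ?muln0 !addn0 !ltn_ord.
Qed.

Lemma box_sumD (Q : nat) (phi psi : point -> R) :
  box_sum Q (fun x => phi x + psi x) = box_sum Q phi + box_sum Q psi.
Proof.
rewrite /box_sum -big_split; apply: eq_bigr => u _ /=.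
by rewrite -big_split; apply: eq_bigr => v _ /=; rewrite -big_split.
Qed.

Lemma box_sumZ (Q : nat) (c : R) (phi : point -> R) :
  box_sum Q (fun x => c * phi x) = c * box_sum Q phi.
Proof. by rewrite /box_sum; do 3 (rewrite mulr_sumr; apply: eq_bigr => ? _). Qed.

Lemma box_sum_sum (I : finType) (Q : nat) (phi : I -> point -> R) :
  box_sum Q (fun x => \sum_i phi i x) = \sum_i box_sum Q (phi i).
Proof.
rewrite /box_sum [RHS]exchange_big; apply: eq_bigr => u _ /=.
rewrite [RHS]exchange_big; apply: eq_bigr => v _ /=.
by rewrite exchange_big.
Qed.

Lemma box_sum_const (Q : nat) (c : R) :
  box_sum Q (fun=> c) = (Q ^ 4)%:R * c.
Proof.
rewrite /box_sum !(sumr_const, card_ord) -!mulrnA mulr_natl.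
by congr (_ *+ _); rewrite -mulnn; ring.
Qed.

(** The box is almost invariant: a shift pushes its points out through three
    faces, which carry at most 3 T Q^3, T Q^3 and T Q^3 points. *)
Lemma box_sum_shift (Q T s t r : nat) (B : R) (phi : point -> R) :
  (T <= Q)%N -> (s <= T)%N -> (t <= T)%N -> (r <= 2 * T ^ 2)%N ->
  (forall x, collar Q T x -> 0 <= phi x <= B) ->
  box_sum Q (phi \o shift s t r) <=
    box_sum Q phi + (5 * T * Q ^ 3)%:R * B.
Proof.
move=> TQ sT tT rT hphi.
have [->|Q0] := posnP Q.
  by rewrite /box_sum !big_ord0 exp0n// muln0 mul0r addr0.
have B0 : 0 <= B.
  suff /hphi/andP[] : collar Q T (0, 0, 0)%N by exact: le_trans.
  by rewrite /collar/=; lia.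
pose D : R := (T * Q ^ 3)%:R * B.
have D0 : 0 <= D by rewrite mulr_ge0.
(* 3 D bounds the error in w: the shift there is at most Q T + 2 T^2 <= 3 T Q *)
have step_w : box_sum Q (phi \o shift s t r) <=
    box_sum Q (fun x => phi (x.1.1 + s, x.1.2 + t, x.2)%N) + 3 * D.
  have -> : 3 * D = \sum_(u < Q) \sum_(v < Q) (3 * T * Q)%:R * B.
    rewrite !sumr_const !card_ord -!mulrnA /D !mulr_natl -!mulrnA.
    by congr (_ *+ _); rewrite -?mulnn; ring.
  rewrite /box_sum -big_split /=; apply: ler_sum => u _.
  rewrite -big_split /=; apply: ler_sum => v _; rewrite /shift /=.
  under eq_bigr do rewrite -addnA.
  have hu := ltn_ord u; have hv := ltn_ord v.
  have h1 : (u * t <= Q * T)%N by rewrite leq_mul// ltnW.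
  have h2 : (T ^ 2 <= Q * T)%N by rewrite -mulnn leq_mul2r TQ orbT.
  apply: le_trans (@interval_shift _ _ B (fun w => phi (u + s, v + t, w)%N) _) _.
    move=> w hw; apply: hphi; rewrite /collar /=; apply/and3P; split; lia.
  by rewrite lerD2l ler_wpM2r// ler_nat; lia.
have step_v : box_sum Q (fun x => phi (x.1.1 + s, x.1.2 + t, x.2)%N) <=
    box_sum Q (fun x => phi (x.1.1 + s, x.1.2, x.2)%N) + D.
  have -> : D = \sum_(u < Q) \sum_(w < Q ^ 2) T%:R * B.
    rewrite !sumr_const !card_ord -!mulrnA /D !mulr_natl -!mulrnA.
    by congr (_ *+ _); rewrite -?mulnn; ring.
  rewrite /box_sum -big_split /=; apply: ler_sum => u _.
  rewrite [leLHS]exchange_big [X in _ <= X + _]exchange_big -big_split /=.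
  apply: ler_sum => w _.
  have hu := ltn_ord u; have hw := ltn_ord w.
  apply: le_trans (@interval_shift _ _ B (fun v => phi (u + s, v, nat_of_ord w)%N) _) _.
    move=> v hv; apply: hphi; rewrite /collar /=; apply/and3P; split; lia.
  by rewrite lerD2l ler_wpM2r// ler_nat.
have step_u : box_sum Q (fun x => phi (x.1.1 + s, x.1.2, x.2)%N) <=
    box_sum Q phi + D.
  have -> : D = \sum_(v < Q) \sum_(w < Q ^ 2) T%:R * B.
    rewrite !sumr_const !card_ord -!mulrnA /D !mulr_natl -!mulrnA.
    by congr (_ *+ _); rewrite -?mulnn; ring.
  rewrite /box_sum [leLHS]exchange_big [X in _ <= X + _]exchange_big /=.
  rewrite -big_split /=; apply: ler_sum => v _.
  rewrite [leLHS]exchange_big [X in _ <= X + _]exchange_big -big_split /=.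
  apply: ler_sum => w _.
  have hv := ltn_ord v; have hw := ltn_ord w.
  apply: le_trans (@interval_shift _ _ B
    (fun u => phi (u, nat_of_ord v, nat_of_ord w)%N) _) _.
    move=> u hu; apply: hphi; rewrite /collar /=; apply/and3P; split; lia.
  by rewrite lerD2l ler_wpM2r// ler_nat.
have -> : (5 * T * Q ^ 3)%:R * B = 3 * D + D + D.
  rewrite -mulnA natrM -mulrA -/D; lra.
lra.
Qed.

End BoxSum.

(** * Slopes along the two horizontal directions *)

(** The direction is a for [false] and b for [true]. *)
Definition step (d : bool) (t : nat) : point -> point :=
  if d then shift 0 t 0 else shift t 0 0.

Lemma step0 d x : step d 0 x = x.
Proof. by case: d x => [] [[u v] w]; rewrite /step /shift /= muln0 !addn0. Qed.

Lemma stepD d m n x : step d (m + n) x = step d n (step d m x).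
Proof.
case: d x => [] [[u v] w]; rewrite /step /shift /=;
  by congr (_, _, _); ring.
Qed.

Definition slope (R : realType) (X : normedModType R) (F : point -> X)
    (d : bool) (n : nat) (x : point) : X :=
  n%:R^-1 *: (F (step d n x) - F x).

Lemma slope_avg (R : realType) (X : normedModType R) (F : point -> X) d n m x :
  slope F d (n * m) x = m%:R^-1 *: \sum_(i < m) slope F d n (step d (n * i) x).
Proof.
rewrite /slope -scaler_sumr scalerA -invfM -natrM; congr (_%:R^-1 *: _).
  by rewrite mulnC.
rewrite -(big_mkord xpredT (fun i => F (step d n (step d (n * i) x)) - F (step d (n * i) x))).
under eq_bigr do rewrite -stepD addnC -mulnS.
by rewrite (telescope_sumr (fun i => F (step d (n * i) x)))// muln0 step0.
Qed.

(** How much the i-th of the m segments of length n that make up the segment of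
    length n * m issued from x departs from the slope of the whole. *)
Definition slope_gap (R : realType) (X : normedModType R) (F : point -> X)
    (d : bool) (n m i : nat) (x : point) : R :=
  `|slope F d n (step d (n * i) x) - slope F d (n * m) x|.

Section GoodScale.
Variables (R : realType) (p : R) (X : normedModType R) (K : R).
Hypotheses (p2 : 2 <= p) (K0 : 0 < K) (cvx : convexity_ineq p X K).
Variables (F : point -> X) (L : R) (Q T : nat).
Hypotheses (TQ : (T <= Q)%N) (L0 : 0 <= L).
Hypothesis slope_le : forall d t x,
  collar Q T x -> (0 < t <= T)%N -> `|slope F d t x| <= L.

Definition energy (d : bool) (n : nat) : R :=
  box_sum Q (fun x => `|slope F d n x| `^ p).

Definition deviation (d : bool) (n m i : nat) (x : point) : R :=
  slope_gap F d n m i x `^ p.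

Definition defect (d : bool) (n m : nat) : R :=
  \sum_(i < m) box_sum Q (deviation d n m i).

Let err : R := (5 * T * Q ^ 3)%:R * L `^ p.

Let p_ge0 : 0 <= p. Proof. by apply: le_trans p2. Qed.

Lemma box_sum_step d t (B : R) (phi : point -> R) :
  (t <= T)%N -> (forall x, collar Q T x -> 0 <= phi x <= B) ->
  box_sum Q (phi \o step d t) <= box_sum Q phi + (5 * T * Q ^ 3)%:R * B.
Proof. by move=> tT h; case: d; apply: box_sum_shift h. Qed.

(** [variance_dyadic] at every point of the box; [err] pays for replacing the
    energy on a translated box by the energy on the box itself. *)
Lemma defect_le (d : bool) (n k : nat) :
  (0 < n)%N -> (n * 2 ^ k <= T)%N ->
  defect d n (2 ^ k) <= (2 * K) `^ p *
    ((2 ^ k)%:R * (energy d n - energy d (n * 2 ^ k) + err)).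
Proof.
move=> n0 nT; rewrite /defect -box_sum_sum.
have nT' : (n <= T)%N by apply: leq_trans nT; rewrite leq_pmulr ?expn_gt0.
apply: (@le_trans _ _ (box_sum Q (fun x => (2 * K) `^ p *
    (\sum_(i < 2 ^ k) `|slope F d n (step d (n * i) x)| `^ p +
     - (2 ^ k)%:R * `|slope F d (n * 2 ^ k) x| `^ p)))).
  apply: box_sum_le => x _; rewrite mulNr.
  apply: (variance_dyadic K0 cvx
    (Z := fun i => slope F d n (step d (n * i) x))).
  exact: slope_avg.
rewrite box_sumZ box_sumD box_sumZ ler_wpM2l ?powR_ge0// box_sum_sum.
rewrite mulrDr mulrBr [leRHS]addrAC -mulNr lerD2r -mulrDr.
rewrite mulr_natl -[X in _ *+ X]card_ord -sumr_const; apply: ler_sum => i _.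
apply: (@box_sum_step d (n * i) (L `^ p) (fun x => `|slope F d n x| `^ p)).
  by rewrite (leq_trans _ nT)// leq_mul2l (ltnW (ltn_ord i)) orbT.
move=> x xc; rewrite powR_ge0 /= ge0_ler_powR// ?nnegrE//.
by apply: slope_le; rewrite ?n0.
Qed.

(** The energies telescope along the scales, leaving the first one, at most
    Q^4 L^p. *)
Lemma defect_sum (d : bool) (k J : nat) : (2 ^ (k * J) <= T)%N ->
  \sum_(j < J) defect d (2 ^ (k * j)) (2 ^ k) <=
  (2 * K) `^ p * ((2 ^ k)%:R * ((Q ^ 4)%:R * L `^ p + J%:R * err)).
Proof.
move=> JT; apply: (@le_trans _ _ (\sum_(j < J) (2 * K) `^ p * ((2 ^ k)%:R *
    (energy d (2 ^ (k * j)) - energy d (2 ^ (k * j.+1)) + err)))).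
  apply: ler_sum => j _.
  have -> : (2 ^ (k * j.+1) = 2 ^ (k * j) * 2 ^ k)%N.
    by rewrite mulnS addnC expnD.
  apply: defect_le; first by rewrite expn_gt0.
  rewrite -expnD addnC -mulnS (leq_trans _ JT)// leq_exp2l//.
  by rewrite leq_mul2l ltn_ord orbT.
rewrite -mulr_sumr ler_wpM2l ?powR_ge0// -mulr_sumr ler_wpM2l//.
rewrite big_split /= sumr_const card_ord -[err *+ _]mulr_natl lerD2r.
rewrite -(big_mkord xpredT (fun j => energy d (2 ^ (k * j)) - energy d (2 ^ (k * j.+1)))).
rewrite (@telescope_sumr_eq _ _ _ (fun j => - energy d (2 ^ (k * j))))//; last first.
  by move=> j _; rewrite opprK addrC.
rewrite muln0 expn0 opprK; apply: (@le_trans _ _ (energy d 1)).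
  by rewrite gerDr oppr_le0; do 3 (apply: sumr_ge0 => ? _); exact: powR_ge0.
rewrite -box_sum_const; apply: box_sum_le => x xc.
apply: ge0_ler_powR; rewrite ?nnegrE//; apply: slope_le.
  by move: xc; rewrite /collar => /and3P[? ? ?]; apply/and3P; split; lia.
by rewrite /= (leq_trans _ JT)// expn_gt0.
Qed.

(** Pigeonhole over the J scales, both directions at once; the condition on Q
    makes the J boundary errors together cost no more than the bound on the
    first energy. *)
Lemma good_scale (k J : nat) :
  (0 < J)%N -> (2 ^ (k * J) <= T)%N -> (5 * T * J <= Q)%N ->
  exists2 j : nat, (j < J)%N &
    J%:R * (defect false (2 ^ (k * j)) (2 ^ k) +
            defect true (2 ^ (k * j)) (2 ^ k)) <=
    4 * (2 * K) `^ p * ((2 ^ k)%:R * ((Q ^ 4)%:R * L `^ p)).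
Proof.
move=> J0 JT JQ; set bound := 4 * _ * _.
pose D (j : nat) := defect false (2 ^ (k * j)) (2 ^ k) +
                    defect true (2 ^ (k * j)) (2 ^ k).
have [[j Dj]|h] := pselect (exists j : 'I_J, J%:R * D j <= bound).
  by exists (nat_of_ord j).
have {}h : forall j : 'I_J, bound / J%:R < D j.
  move=> j; rewrite ltr_pdivrMr ?ltr0n// ltNge mulrC; apply/negP => Dj.
  by apply: h; exists j.
have lt1 : bound < \sum_(j < J) D j.
  have -> : bound = \sum_(j < J) bound / J%:R.
    by rewrite sumr_const card_ord -[(_ / _) *+ _]mulr_natr divfK// pnatr_eq0 -lt0n.
  case: (J) J0 h => // J' _ h; apply: ltr_sum => //.
  by apply/hasP; exists ord0; rewrite ?mem_index_enum.
have le1 : J%:R * err <= (Q ^ 4)%:R * L `^ p.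
  rewrite /err mulrA -natrM ler_wpM2r ?powR_ge0// ler_nat.
  have -> : (J * (5 * T * Q ^ 3) = (5 * T * J) * Q ^ 3)%N by ring.
  by rewrite [(Q ^ 4)%N]expnS leq_mul2r JQ orbT.
have le2 d : \sum_(j < J) defect d (2 ^ (k * j)) (2 ^ k) <=
    (2 * K) `^ p * ((2 ^ k)%:R * (2 * ((Q ^ 4)%:R * L `^ p))).
  apply: le_trans (defect_sum d JT) _; rewrite ler_wpM2l ?powR_ge0//.
  by rewrite ler_wpM2l//; lra.
have := lerD (le2 false) (le2 true); rewrite -big_split /= => le3.
have := lt_le_trans lt1 le3; rewrite /bound.
set A := (2 * K) `^ p; set B := (2 ^ k)%:R; set C := (Q ^ 4)%:R; set E := L `^ p.
have -> : A * (B * (2 * (C * E))) + A * (B * (2 * (C * E))) =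
  4 * A * (B * (C * E)) by ring.
by rewrite ltxx.
Qed.

End GoodScale.

(** * The commutator estimate *)

Definition big_box (Q : nat) (x : point) : bool :=
  [&& x.1.1 <= 2 * Q, x.1.2 <= 2 * Q & x.2 <= 4 * Q ^ 2]%N.

Lemma big_box_shift Q s t r x : big_box Q (shift s t r x) -> big_box Q x.
Proof.
rewrite /big_box /shift /= => /and3P[h1 h2 h3].
by apply/and3P; split; lia.
Qed.

Lemma collar_shift Q T s t r x : (s <= T)%N -> (t <= T)%N ->
  (r <= 2 * T ^ 2)%N -> collar Q 0 x -> collar Q T (shift s t r x).
Proof.
rewrite /collar /shift /= => sT tT rT /and3P[h1 h2 h3].
have h4 : (x.1.1 * t <= Q * T)%N by apply: leq_mul => //; lia.
by apply/and3P; split; lia.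
Qed.

Lemma collar_big Q T s t r x : (5 * T <= Q)%N -> (s <= 2 * T)%N ->
  (t <= 2 * T)%N -> (r <= T ^ 2)%N -> collar Q T x ->
  big_box Q (shift s t r x).
Proof.
rewrite /collar /big_box /shift /= => TQ sT tT rT /and3P[h1 h2 h3].
have h4 : (x.1.1 * t <= (Q + T) * (2 * T))%N by apply: leq_mul => //; lia.
have h5 : (5 * T * Q <= Q ^ 2)%N by rewrite -mulnn leq_mul2r TQ orbT.
have h6 : (5 * T * T <= Q * T)%N by rewrite leq_mul2r TQ orbT.
by apply/and3P; split; lia.
Qed.

Lemma collar_big_step Q T d t x : (5 * T <= Q)%N -> (t <= 2 * T)%N ->
  collar Q T x -> big_box Q (step d t x).
Proof. by move=> TQ tT; case: d; apply: collar_big. Qed.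

Lemma subr_chain (V : zmodType) (a b c : V) : b - a + (c - b) = c - a.
Proof. by rewrite addrC addrA subrK. Qed.

Lemma commutator_shift_le (n m i T : nat) :
  (0 < n)%N -> (n * m <= T)%N -> (i < m)%N ->
  [/\ (n * i + n <= T)%N, (n ^ 2 * m + (n * i) ^ 2 <= 2 * T ^ 2)%N,
      (n ^ 2 * m + (n * i) ^ 2 + (n * i + n) * n <= 2 * T ^ 2)%N,
      (n ^ 2 * m + n ^ 2 <= 2 * T ^ 2)%N &
      (n ^ 2 * (m - i) <= 2 * T ^ 2)%N].
Proof.
move=> n0 nT im; set s := (n * i)%N.
have snT : (s + n <= T)%N.
  by rewrite addnC -mulnS (leq_trans _ nT)// leq_mul2l im orbT.
have n2T : (n ^ 2 * m <= T ^ 2)%N.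
  rewrite -mulnn -mulnA (leq_trans (leq_mul (leqnn n) nT))// -mulnn.
  by rewrite leq_mul2r (leq_trans _ nT) ?orbT// leq_pmulr// (leq_ltn_trans _ im).
have snT2 : (s ^ 2 + 2 * (s * n) + n ^ 2 <= T ^ 2)%N.
  by rewrite addnAC -sqrnD leq_sqr.
have miT : (n ^ 2 * (m - i) <= n ^ 2 * m)%N by rewrite leq_mul2l leq_subr orbT.
by split; rewrite ?mulnDl ?mulnn; lia.
Qed.

Section Commutator.
Variables (R : realType) (X : normedModType R).
Variables (F : point -> X) (L : R) (Q T : nat).
Hypotheses (TQ : (5 * T <= Q)%N) (L0 : 0 <= L).
Hypothesis F_step : forall d t x,
  big_box Q (step d t x) -> `|F (step d t x) - F x| <= L * t%:R.
Hypothesis F_center : forall n m r x, (0 < m)%N -> (r <= m ^ 2)%N ->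
  big_box Q (shift 0 0 (n ^ 2 * r) x) ->
  `|F (shift 0 0 (n ^ 2 * r) x) - F x| <= L * (8 * n * m)%:R.
Hypothesis F_expand : forall n x,
  big_box Q (shift 0 0 (n ^ 2) x) ->
  n%:R <= `|F (shift 0 0 (n ^ 2) x) - F x|.

Lemma slope_le_Lip d t x : big_box Q (step d t x) -> `|slope F d t x| <= L.
Proof.
move=> /F_step h; have [->|t0] := posnP t.
  by rewrite /slope invr0 scale0r normr0.
rewrite /slope normrZ ger0_norm ?invr_ge0// mulrC ler_pdivrMr//.
by rewrite ltr0n.
Qed.

(** [close_above] and [close_below] treat points x and y that differ by one
    horizontal step and a central factor, c being put on the side that keeps
    its exponent nonnegative. *)
Lemma close_above d n m r x y : (0 < m)%N -> (r <= m ^ 2)%N ->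
  y = shift 0 0 (n ^ 2 * r) (step d n x) -> big_box Q y ->
  `|F x - F y| <= L * (9 * n * m)%:R.
Proof.
move=> m0 rm yE yb.
have b1 : big_box Q (step d n x) by move: yb; rewrite yE => /big_box_shift.
have h1 := F_step b1.
have h2 : `|F y - F (step d n x)| <= L * (8 * n * m)%:R.
  by rewrite yE; apply: F_center => //; rewrite -yE.
have -> : F x - F y = - (F (step d n x) - F x) - (F y - F (step d n x)).
  by rewrite opprB opprB addrA subrK.
apply: le_trans (ler_normB _ _) _; rewrite normrN.
apply: le_trans (lerD h1 h2) _; rewrite -mulrDr -natrD ler_wpM2l// ler_nat.
have : (n <= n * m)%N by rewrite leq_pmulr.
lia.
Qed.

Lemma close_below d n m r x y : (0 < m)%N -> (r <= m ^ 2)%N ->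
  shift 0 0 (n ^ 2 * r) y = step d n x -> big_box Q (step d n x) ->
  `|F x - F y| <= L * (9 * n * m)%:R.
Proof.
move=> m0 rm yE xb.
have h1 := F_step xb.
have h2 : `|F (step d n x) - F y| <= L * (8 * n * m)%:R.
  by rewrite -yE; apply: F_center => //; rewrite yE.
have -> : F x - F y = - (F (step d n x) - F x) + (F (step d n x) - F y).
  by rewrite opprB addrA subrK.
apply: le_trans (ler_normD _ _) _; rewrite normrN.
apply: le_trans (lerD h1 h2) _; rewrite -mulrDr -natrD ler_wpM2l// ler_nat.
have : (n <= n * m)%N by rewrite leq_pmulr.
lia.
Qed.

(** Two parallel segments of length n m^2 whose ends are O(n m) apart have
    slopes within O(L / m). *)
Lemma slope_close d n m x y : (0 < n)%N -> (0 < m)%N ->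
  `|F x - F y| <= L * (9 * n * m)%:R ->
  `|F (step d (n * m ^ 2) x) - F (step d (n * m ^ 2) y)| <=
    L * (9 * n * m)%:R ->
  `|slope F d (n * m ^ 2) x - slope F d (n * m ^ 2) y| <= 18 * L / m%:R.
Proof.
move=> n0 m0 h1 h2; rewrite /slope -scalerBr normrZ ger0_norm ?invr_ge0//.
set A := F (step d _ x) in h2 *; set B := F (step d _ y) in h2 *.
have -> : A - F x - (B - F y) = (A - B) - (F x - F y).
  by rewrite !opprD !opprK addrACA.
rewrite ler_pdivrMl ?ltr0n ?muln_gt0 ?n0 ?expn_gt0 ?m0//.
apply: le_trans (ler_normB _ _) _; apply: le_trans (lerD h2 h1) _.
have m0' : (m%:R : R) != 0 by rewrite pnatr_eq0 -lt0n.
rewrite -mulnn !natrM.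
have -> : n%:R * (m%:R * m%:R) * (18 * L / m%:R) = 18 * n%:R * m%:R * L :> R.
  by field.
lra.
Qed.

Lemma slope_gap_le d n m i x : (0 < n)%N -> (n * m <= T)%N -> (i < m)%N ->
  collar Q T x -> slope_gap F d n m i x <= 2 * L.
Proof.
move=> n0 nT im xc; rewrite /slope_gap.
apply: le_trans (ler_normB _ _) _.
have -> : 2 * L = L + L by ring.
apply: lerD; apply: slope_le_Lip.
  rewrite -stepD addnC -mulnS; apply: collar_big_step xc => //.
  have : (n * i.+1 <= n * m)%N by rewrite leq_mul2l im orbT.
  lia.
by apply: collar_big_step xc => //; lia.
Qed.

(** The loop a^n, b^n, a^-n, b^-n displaces F by n times the sum of two slope
    differences, one between parallel a-edges and one between parallel b-edges.
    Comparing each edge with the long segment that contains it costs one gap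
    per edge, and comparing parallel long segments costs 18 L / m twice.  The
    first two shifted points are the origins of the long segments that carry
    the a-edges, the last two of those that carry the b-edges; each edge is the
    i-th short segment of its long one.  The central offset n^2 m^2 keeps the
    third coordinate of the last point nonnegative. *)
Lemma commutator_slopes (n m i : nat) (x : point) :
  (0 < n)%N -> (0 < m)%N -> (n * m ^ 2 <= T)%N -> (i < m ^ 2)%N ->
  collar Q 0 x ->
  let s := (n * i)%N in
  1 <= slope_gap F false n (m ^ 2) i
         (shift 0 s (n ^ 2 * m ^ 2 + s ^ 2) x) +
       slope_gap F false n (m ^ 2) i
         (shift 0 (s + n) (n ^ 2 * m ^ 2 + s ^ 2 + (s + n) * n) x) +
       slope_gap F true n (m ^ 2) i
         (shift s 0 (n ^ 2 * m ^ 2 + n ^ 2) x) +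
       slope_gap F true n (m ^ 2) i
         (shift (s + n) 0 (n ^ 2 * (m ^ 2 - i)) x) +
       36 * L / m%:R.
Proof.
move=> n0 m0 nT im xc; cbv zeta; set s := (n * i)%N.
set y := shift 0 s _ x; set y' := shift 0 (s + n) _ x.
set z := shift s 0 _ x; set z' := shift (s + n) 0 _ x.
have [e mE] : exists e, (m ^ 2 = i + 1 + e)%N.
  by exists (m ^ 2 - i - 1)%N; lia.
have em : (e <= m ^ 2)%N by lia.
have miE : (m ^ 2 - i = e + 1)%N by lia.
have [snT r1 r2 r3 r4] := commutator_shift_le n0 nT im.
have sT : (s <= T)%N by lia.
have n2T : (n ^ 2 * m ^ 2 <= T ^ 2)%N.
  rewrite -expnMn leq_sqr (leq_trans _ nT)// leq_mul2l -mulnn leq_pmulr//.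
  by rewrite orbT.
have yc : collar Q T y by exact: collar_shift.
have yc' : collar Q T y' by exact: collar_shift.
have zc : collar Q T z by exact: collar_shift.
have zc' : collar Q T z' by exact: collar_shift.
(* the loop starts at step false s y and its corners are the common ends of
   the four edges; it closes up to the central factor c^(n^2) *)
have E1 : step false n (step false s y) = step true s z'.
  by rewrite /z' miE /y mE /s /step /shift /=; congr (_, _, _); ring.
have E2 : step true n (step true s z') = step false n (step false s y').
  by rewrite /z' miE /y' mE /s /step /shift /=; congr (_, _, _); ring.
have E3 : step true n (step true s z) = step false s y'.
  by rewrite /z /y' mE /s /step /shift /=; congr (_, _, _); ring.
have E4 : step true s z = shift 0 0 (n ^ 2) (step false s y).
  by rewrite /z /y mE /s /step /shift /=; congr (_, _, _); ring.
have im1 : (i + 1 <= m ^ 2)%N by lia.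
have nT2 : (n + n * m ^ 2 <= 2 * T)%N by lia.
(* parallel long segments are close at both ends *)
have C1 : `|F y - F y'| <= L * (9 * n * m)%:R.
  apply: (@close_above true n m (i + 1)) => //.
    by rewrite /y /y' mE /s /step /shift /=; congr (_, _, _); ring.
  by rewrite -(step0 true y'); exact: collar_big_step yc'.
have C2 : `|F (step false (n * m ^ 2) y) - F (step false (n * m ^ 2) y')|
    <= L * (9 * n * m)%:R.
  apply: (@close_below true n m e) => //.
    by rewrite /y /y' mE /s /step /shift /=; congr (_, _, _); ring.
  have -> : step true n (step false (n * m ^ 2) y) =
      shift (n * m ^ 2) n (n * m ^ 2 * n) y.
    by rewrite /step /shift /=; congr (_, _, _); ring.
  by apply: collar_big yc => //; lia.
have C3 : `|F z - F z'| <= L * (9 * n * m)%:R.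
  apply: (@close_below false n m (i + 1)) => //.
    by rewrite /z /z' miE mE /s /step /shift /=; congr (_, _, _); ring.
  by apply: collar_big_step zc => //; lia.
have C4 : `|F (step true (n * m ^ 2) z) - F (step true (n * m ^ 2) z')|
    <= L * (9 * n * m)%:R.
  apply: (@close_above false n m e) => //.
    by rewrite /z /z' miE mE /s /step /shift /=; congr (_, _, _); ring.
  by apply: collar_big_step zc' => //; lia.
have S1 := slope_close n0 m0 C1 C2.
have S2 := slope_close n0 m0 C3 C4.
have big4 : big_box Q (shift 0 0 (n ^ 2) (step false s y)).
  by rewrite -E4; apply: collar_big_step zc => //; rewrite (leq_trans sT)// leq_pmull.
have nR : (0 : R) < n%:R by rewrite ltr0n.
have Fslope d w : F (step d n w) - F w = n%:R *: slope F d n w.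
  by rewrite /slope scalerA divff ?scale1r// gt_eqF.
have key : F (shift 0 0 (n ^ 2) (step false s y)) - F (step false s y) =
    n%:R *: ((slope F false n (step false s y) - slope F false n (step false s y'))
      + (slope F true n (step true s z') - slope F true n (step true s z))).
  rewrite -E4 scalerDr !scalerBr -!Fslope E1 E2 E3.
  by rewrite !opprB addrACA !subr_chain.
have := F_expand big4; rewrite key normrZ (gtr0_norm nR).
rewrite -[X in X <= _]mulr1 ler_pM2l// => h; apply: le_trans h _.
rewrite /slope_gap -/s.
have tri (a b c d : X) : `|a - b| <= `|a - c| + `|c - d| + `|b - d|.
  rewrite (distrC b d); apply: le_trans (ler_distD c _ _) _.
  by rewrite -addrA lerD2l ler_distD.
apply: le_trans (ler_normD _ _) _.
have := tri (slope F false n (step false s y)) (slope F false n (step false s y'))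
  (slope F false (n * m ^ 2) y) (slope F false (n * m ^ 2) y').
have := tri (slope F true n (step true s z')) (slope F true n (step true s z))
  (slope F true (n * m ^ 2) z') (slope F true (n * m ^ 2) z).
rewrite (distrC (slope F true (n * m ^ 2) z') (slope F true (n * m ^ 2) z)).
have -> : 36 * L / m%:R = 18 * L / m%:R + 18 * L / m%:R by lra.
move: S1 S2; lra.
Qed.

End Commutator.

(** * The number of scales *)

Lemma powR_le_sum4 (R : realType) (p h a b c d : R) :
  0 <= p -> 0 <= h -> 0 <= a -> 0 <= b -> 0 <= c -> 0 <= d ->
  4 * h <= a + b + c + d ->
  h `^ p <= a `^ p + b `^ p + c `^ p + d `^ p.
Proof.
move=> p0 h0 a0 b0 c0 d0 sum_ge.
have pw x : 0 <= x -> h <= x -> h `^ p <= x `^ p.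
  by move=> x0 hx; rewrite ge0_ler_powR// nnegrE.
have := powR_ge0 a p; have := powR_ge0 b p.
have := powR_ge0 c p; have := powR_ge0 d p.
have [/(pw _ a0)|ha] := leP h a; first lra.
have [/(pw _ b0)|hb] := leP h b; first lra.
have [/(pw _ c0)|hc] := leP h c; first lra.
have /(pw _ d0) : h <= d by lra.
lra.
Qed.

Section ScaleCount.
Variables (R : realType) (p : R) (X : normedModType R) (K : R).
Hypotheses (p2 : 2 <= p) (K1 : 1 <= K) (cvx : convexity_ineq p X K).
Variables (F : point -> X) (L : R) (Q k J : nat).
Let T : nat := (2 ^ (k * 2 * J))%N.
Hypotheses (J0 : (0 < J)%N) (JQ : (5 * T * J <= Q)%N).
Hypotheses (L0 : 0 <= L) (Lk : 72 * L <= (2 ^ k)%:R).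
Hypothesis F_step : forall d t x,
  big_box Q (step d t x) -> `|F (step d t x) - F x| <= L * t%:R.
Hypothesis F_center : forall n m r x, (0 < m)%N -> (r <= m ^ 2)%N ->
  big_box Q (shift 0 0 (n ^ 2 * r) x) ->
  `|F (shift 0 0 (n ^ 2 * r) x) - F x| <= L * (8 * n * m)%:R.
Hypothesis F_expand : forall n x,
  big_box Q (shift 0 0 (n ^ 2) x) ->
  n%:R <= `|F (shift 0 0 (n ^ 2) x) - F x|.

Let TQ : (5 * T <= Q)%N.
Proof. by apply: leq_trans JQ; rewrite leq_pmulr. Qed.

Let p0 : 0 <= p. Proof. by apply: le_trans p2. Qed.

Let K0 : 0 < K. Proof. by apply: lt_le_trans K1. Qed.

(** At the good scale the four gaps of [commutator_slopes] sum to at least 1/2,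
    so their p-th powers sum to at least 8^(-p); averaging over the box and
    over i bounds that sum by twice the total defect, up to boundary terms. *)
Lemma scale_count : J%:R <= 12 * (16 * (K * L)) `^ p.
Proof.
have T0 : (0 < T)%N by rewrite expn_gt0.
have TQ1 : (T <= Q)%N by apply: leq_trans TQ; rewrite leq_pmull.
have slope_le d t x : collar Q T x -> (0 < t <= T)%N -> `|slope F d t x| <= L.
  move=> xc /andP[_ tT]; apply: (slope_le_Lip L0 F_step).
  by apply: collar_big_step xc => //; rewrite (leq_trans tT)// leq_pmull.
have [j jJ] := good_scale p2 K0 cvx TQ1 L0 slope_le J0 (leqnn _) JQ.
set n := (2 ^ (k * 2 * j))%N; set M := (2 ^ (k * 2))%N => good.
pose m := (2 ^ k)%N; have Lm : 72 * L <= m%:R by [].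
have ME : M = (m ^ 2)%N by rewrite /M expnM.
have n0 : (0 < n)%N by rewrite expn_gt0.
have m0 : (0 < m)%N by rewrite expn_gt0.
have M0 : (0 < M)%N by rewrite expn_gt0.
have nMT : (n * M <= T)%N.
  rewrite -expnD addnC -mulnS leq_exp2l// leq_mul2l jJ orbT//.
pose E : R := (5 * T * Q ^ 3)%:R * (2 * L) `^ p.
have dev_le d i (s t r : nat) : (i < M)%N -> (s <= T)%N -> (t <= T)%N ->
    (r <= 2 * T ^ 2)%N ->
    box_sum Q (deviation p F d n M i \o shift s t r) <=
    box_sum Q (deviation p F d n M i) + E.
  move=> iM sT tT rT; apply: box_sum_shift => // x xc.
  rewrite powR_ge0 /= ge0_ler_powR ?nnegrE ?mulr_ge0//.
    exact: normr_ge0.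
  exact: (slope_gap_le TQ L0 F_step _ n0 nMT iM xc).
have one i : (i < M)%N -> (Q ^ 4)%:R * 8^-1 `^ p <=
    2 * (box_sum Q (deviation p F false n M i) +
         box_sum Q (deviation p F true n M i)) + 4 * E.
  move=> iM; set s := (n * i)%N.
  have [snT r1 r2 r3 r4] := commutator_shift_le n0 nMT iM.
  have le1 := @dev_le false i 0%N s (n ^ 2 * M + s ^ 2)%N iM.
  have le2 := @dev_le false i 0%N (s + n)%N (n ^ 2 * M + s ^ 2 + (s + n) * n)%N iM.
  have le3 := @dev_le true i s 0%N (n ^ 2 * M + n ^ 2)%N iM.
  have le4 := @dev_le true i (s + n)%N 0%N (n ^ 2 * (M - i))%N iM.
  have sT : (s <= T)%N by apply: leq_trans snT; rewrite leq_addr.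
  have := lerD (lerD (lerD (le1 (leq0n _) sT r1) (le2 (leq0n _) snT r2))
    (le3 sT (leq0n _) r3)) (le4 snT (leq0n _) r4).
  set a := box_sum Q (deviation p F false n M i).
  set b := box_sum Q (deviation p F true n M i).
  have -> : a + E + (a + E) + (b + E) + (b + E) = 2 * (a + b) + 4 * E by ring.
  apply: le_trans; rewrite -box_sum_const -!box_sumD.
  apply: box_sum_le => x xc; apply: powR_le_sum4 => //; try exact: normr_ge0.
  have iM' := iM; rewrite ME in iM'; have nMT' := nMT; rewrite ME in nMT'.
  have := commutator_slopes TQ L0 F_step F_center F_expand n0 m0 nMT' iM' xc.
  cbv zeta; rewrite -ME -/s.
  have : 36 * L / m%:R <= 2^-1 by rewrite ler_pdivrMr ?ltr0n//; move: Lm; lra.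
  by lra.
have total : M%:R * ((Q ^ 4)%:R * 8^-1 `^ p) <=
    2 * (defect p F Q false n M + defect p F Q true n M) + M%:R * (4 * E).
  apply: (@le_trans _ _ (\sum_(i < M)
      (2 * (box_sum Q (deviation p F false n M i) +
            box_sum Q (deviation p F true n M i)) + 4 * E))).
    rewrite -[in leLHS](card_ord M) mulr_natl -sumr_const.
    by apply: ler_sum => i _; exact: one.
  rewrite big_split /= sumr_const card_ord -mulr_sumr big_split /=.
  by rewrite -[4 * E *+ M]mulr_natl.
set V : R := (Q ^ 4)%:R.
set B := (2 * L) `^ p.
have JE : J%:R * E <= V * B.
  rewrite /E mulrA -natrM ler_wpM2r ?powR_ge0// ler_nat.
  have -> : (J * (5 * T * Q ^ 3) = (5 * T * J) * Q ^ 3)%N by ring.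
  by rewrite [(Q ^ 4)%N]expnS leq_mul2r JQ orbT.
pose W := (2 * (K * L)) `^ p.
have BW : B <= W.
  rewrite ge0_ler_powR ?nnegrE ?mulr_ge0 ?(ltW K0)//.
  by rewrite ler_wpM2l// ler_peMl.
have goodW : J%:R * (defect p F Q false n M + defect p F Q true n M) <=
    4 * (M%:R * (V * W)).
  have WE : W = (2 * K) `^ p * L `^ p.
    by rewrite /W mulrA powRM// mulr_ge0// ltW.
  apply: le_trans good _; rewrite WE.
  by rewrite le_eqVlt; apply/orP; left; apply/eqP; ring.
have MR : (0 : R) < M%:R by rewrite ltr0n.
have VR : 0 < V by rewrite ltr0n expn_gt0 (leq_trans _ TQ1).
have JR : 0 <= J%:R :> R by [].
have JhW : J%:R * 8^-1 `^ p <= 12 * W.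
  have {}total := ler_wpM2l JR total.
  have h1 : M%:R * (J%:R * E) <= M%:R * (V * B) by rewrite ler_wpM2l.
  have h2 : M%:R * (V * B) <= M%:R * (V * W) by rewrite !ler_wpM2l// ltW.
  rewrite -(ler_pM2l VR) -(ler_pM2l MR).
  have -> : M%:R * (V * (J%:R * 8^-1 `^ p)) = J%:R * (M%:R * (V * 8^-1 `^ p)).
    by ring.
  have -> : M%:R * (V * (12 * W)) = 12 * (M%:R * (V * W)) by ring.
  move: total h1 h2 goodW; rewrite mulrDr.
  set D := defect p F Q false n M + _.
  have -> : J%:R * (2 * D) = 2 * (J%:R * D) by ring.
  have -> : J%:R * (M%:R * (4 * E)) = 4 * (M%:R * (J%:R * E)) by ring.
  by lra.
have h0 : 0 < 8^-1 `^ p :> R by rewrite powR_gt0.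
have -> : (16 * (K * L)) `^ p = W / 8^-1 `^ p.
  rewrite -[LHS](mulfK (lt0r_neq0 h0)); congr (_ / _).
  rewrite /W -powRM ?mulr_ge0 ?(ltW K0)//.
  by congr (_ `^ _); lra.
by rewrite mulrA ler_pdivlMr.
Qed.

End ScaleCount.

(** * From an embedding of a ball to the distortion bound *)

Lemma heis_pt_shift (s t r : nat) (x : point) :
  (heis_pt (shift s t r x).1.1 (shift s t r x).1.2 (shift s t r x).2 =
   heis_pt x.1.1 x.1.2 x.2 * heis_b ^+ t * heis_a ^+ s * heis_c ^+ r)%g.
Proof. by rewrite /shift /= heis_pt_c heis_pt_a heis_pt_b. Qed.

Lemma big_box_ball (R : realType) (r : R) (Q : nat) (x : point) :
  (0 < Q)%N -> (20 * Q)%:R <= r -> big_box Q x ->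
  heis_ball r (heis_pt x.1.1 x.1.2 x.2).
Proof.
move=> Q0 Qr /and3P[uQ vQ wQ]; rewrite /heis_ball /=; apply: le_trans Qr.
rewrite ler_nat -[heis_pt _ _ _]mul1g dW_mul /heis_pt.
have -> : (20 * Q = 2 * Q + 2 * Q + 16 * Q)%N by ring.
apply: word_lengthM_le; first apply: word_lengthM_le.
- exact: leq_trans (word_length_bX _) vQ.
- exact: leq_trans (word_length_aX _) uQ.
- have := @word_length_cX 1 (2 * Q) x.2; rewrite exp1n mul1n muln1 => h.
  apply: leq_trans (h _ _) _; [lia|by rewrite expnMn|lia].
Qed.

Section Embedding.
Variables (R : realType) (X : normedModType R) (r D : R) (f : heis -> X).
Hypothesis D1 : 1 <= D.
Hypothesis f_biLip : forall x y, heis_ball r x -> heis_ball r y ->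
  (dW x y)%:R <= `|f x - f y| <= D * (dW x y)%:R.

Let D0 : 0 <= D. Proof. exact: le_trans D1. Qed.

(** [scale_count] applies with Q = 5 T J, where T is the largest scale: the
    box of points that it visits lies in the ball as soon as 20 Q <= r. *)
Lemma embedding_scale_count (p K : R) (k J : nat) :
  2 <= p -> 1 <= K -> convexity_ineq p X K ->
  72 * D <= (2 ^ k)%:R -> (0 < J)%N ->
  (100 * 2 ^ (k * 2 * J) * J)%:R <= r ->
  J%:R <= 12 * (16 * (K * D)) `^ p.
Proof.
move=> p2 K1 cvx Dk J0 Jr.
pose Q := (5 * 2 ^ (k * 2 * J) * J)%N.
have Q0 : (0 < Q)%N by rewrite !muln_gt0 expn_gt0 J0.
have Qr : (20 * Q)%:R <= r.
  by rewrite (le_trans _ Jr)// ler_nat /Q !mulnA.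
pose P (x : point) := heis_pt x.1.1 x.1.2 x.2.
have lip s t q x : big_box Q (shift s t q x) ->
    (dW (P x) (P (shift s t q x)))%:R <=
      `|f (P (shift s t q x)) - f (P x)| <=
      D * (dW (P x) (P (shift s t q x)))%:R.
  move=> xb; rewrite distrC; apply: f_biLip; apply: (big_box_ball Q0 Qr) => //.
  exact: big_box_shift xb.
apply: (scale_count (F := f \o P) (Q := Q) p2 K1 cvx J0 _ D0 Dk) => //=.
- move=> d t x xb.
  have : (dW (P x) (P (step d t x)) <= t)%N.
    case: d xb => _; rewrite /P /step heis_pt_shift ?expg0 ?mulg1.
      by rewrite dW_mul word_length_bX.
    by rewrite dW_mul word_length_aX.
  rewrite -(ler_nat R) => h.
  have /andP[_] : (dW (P x) (P (step d t x)))%:R <=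
      `|f (P (step d t x)) - f (P x)| <= D * (dW (P x) (P (step d t x)))%:R.
    by case: d xb {h}; exact: lip.
  by move=> /le_trans; apply; rewrite ler_wpM2l.
- move=> n m q x m0 qm /lip /andP[_] /le_trans; apply; rewrite ler_wpM2l//.
  by rewrite ler_nat /P heis_pt_shift !expg0 !mulg1 dW_mul word_length_cX.
- move=> n x /lip /andP[h _]; apply: le_trans h.
  by rewrite ler_nat /P heis_pt_shift !expg0 !mulg1 dW_cX_ge.
Qed.

Lemma embedding_target_nonzero : 4 <= r -> exists v : X, v != 0.
Proof.
move=> r4; exists (f heis_c - f 1%g); rewrite subr_eq0; apply/eqP => fE.
have ball1 : heis_ball r 1%g.
  rewrite /heis_ball /= -[X in dW _ X]mulg1 -(expg0 heis_a) dW_mul.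
  by have := word_length_aX 0; rewrite leqn0 => /eqP->; apply: le_trans r4.
have ballc : heis_ball r heis_c.
  rewrite /heis_ball /= -[X in dW _ X]mul1g dW_mul; apply: le_trans r4.
  by rewrite (ler_nat _ _ 4); exact: (word_length_cXM 1 1).
have /andP[+ _] := f_biLip ball1 ballc.
rewrite fE subrr normr0 (ler_nat _ _ 0); have := dW_cX_ge 1%g 1.
by rewrite exp1n expg1 mul1g => /leq_trans h /h.
Qed.

End Embedding.

(** Test the inequality on the pair v, -v, whose midpoint vanishes. *)
Lemma convexity_ge1 (R : realType) (p : R) (X : normedModType R) (K : R) :
  2 <= p -> (exists v : X, v != 0) -> 0 < K -> convexity_ineq p X K -> 1 <= K.
Proof.
move=> p2 [v v0] K0 /(_ v (- v)).
have p0 : 0 < p by apply: lt_le_trans p2.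
have V0 : 0 < `|v| `^ p by rewrite powR_gt0// normr_gt0.
rewrite subrr scaler0 normr0 powR0 ?gt_eqF// opprK normrN.
have -> : 2^-1 *: (v + v) = v.
  by rewrite -mulr2n -[v *+ 2]scaler_nat scalerA mulVf// scale1r.
set V := `|v| `^ p in V0 *; have -> : (V + V) / 2 = V by lra.
rewrite subr_ge0 ger_pMl// => Kp.
rewrite leNgt; apply/negP => K1.
have : K `^ p < 1 `^ p by apply: gt0_ltr_powR; rewrite ?nnegrE// ltW.
rewrite powR1 => /(conj (powR_gt0 p K0))/andP; rewrite -invf_gt1 ?powR_gt0//.
by rewrite ltNge Kp andbF.
Qed.

Lemma ln_ge_1subV (R : realType) (x : R) : 0 < x -> 1 - x^-1 <= ln x.
Proof.
move=> x0; have x'0 : 0 < x^-1 by rewrite invr_gt0.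
have : ln (1 + (x^-1 - 1)) <= x^-1 - 1 by apply: le_ln1Dx; lra.
by rewrite addrC subrK lnV ?posrE//; lra.
Qed.

Lemma ln_le_sub1 (R : realType) (x : R) : 0 < x -> ln x <= x - 1.
Proof.
move=> x0; have : ln (1 + (x - 1)) <= x - 1 by apply: le_ln1Dx; lra.
by rewrite addrC subrK.
Qed.

(** Write 4 as (4/3)(3/2)2 and bound each factor with [ln_ge_1subV].  A bound
    above 1 keeps ln (ln r) away from 0 for r >= 4. *)
Lemma ln4_gt1 (R : realType) : 13 / 12 <= ln 4 :> R.
Proof.
have -> : ln 4 = ln (4 / 3) + (ln (3 / 2) + ln 2) :> R.
  by rewrite -!lnM ?posrE; [congr ln| | | |]; lra.
have := @ln_ge_1subV R (4 / 3) ltac:(lra).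
have := @ln_ge_1subV R (3 / 2) ltac:(lra).
have := @ln_ge_1subV R 2 ltac:(lra); rewrite !invf_div; lra.
Qed.

Lemma pow2_between (R : realType) (a : R) : 1 <= a ->
  exists2 k : nat, (0 < k)%N & a <= (2 ^ k)%:R <= 2 * a.
Proof.
move=> a1.
have ex : exists k, a <= (2 ^ k)%:R.
  exists (Num.truncn a).+1.
  have /andP[_ /ltW h] := truncn_itv (le_trans ler01 a1).
  by apply: le_trans h _; rewrite ler_nat ltnW// ltn_expl.
case: (ex_minnP ex) => k ak kmin.
have [k0|k0] := posnP k.
  exists 1%N => //; rewrite k0 expn0 in ak; rewrite expn1; lra.
exists k => //; rewrite ak /= -(prednK k0) expnS natrM ler_wpM2l//.
rewrite ltW// ltNge; apply/negP => /kmin; rewrite -ltnS prednK// => h.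
by move: (h); rewrite ltnn.
Qed.

Lemma ln_le_sixteenth (R : realType) (x : R) : 1024 <= x -> 16 * ln x <= x.
Proof.
move=> x1024; have x0 : 0 < x by lra.
have s0 : 0 < Num.sqrt x by rewrite sqrtr_gt0.
have lx : ln x <= 2 * Num.sqrt x.
  rewrite -{1}(sqr_sqrtr (ltW x0)) lnXn// -[ln _ *+ 2]mulr_natl ler_wpM2l//.
  by have := ln_le_sub1 s0; lra.
have s32 : 32 <= Num.sqrt x.
  have -> : 32 = Num.sqrt (32 ^+ 2) :> R by rewrite sqrtr_sqr ger0_norm.
  by rewrite ler_wsqrtr//; lra.
rewrite -[leRHS](sqr_sqrtr (ltW x0)) expr2.
apply: le_trans (_ : 32 * Num.sqrt x <= _); first lra.
by rewrite ler_wpM2r// ltW.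
Qed.

(** Take 2^k of order D and J the integer part of ln r / (16 ln (ln r)).  Then
    ln (2^k) <= 2 ln (ln r), so the largest scale T = 2^(2kJ) has logarithm at most
    4 J ln (ln r) <= ln r / 4; as J <= T, the product 100 T J is at most
    100 T^2, hence at most r. *)
Lemma scales_fit (R : realType) (r D : R) :
  0 < r -> 1024 <= ln r -> 1 <= D <= ln r ->
  exists k J : nat,
    [/\ 72 * D <= (2 ^ k)%:R, (0 < J)%N,
        (100 * 2 ^ (k * 2 * J) * J)%:R <= r &
        ln r / ln (ln r) <= 32 * J%:R].
Proof.
move=> r0; set x := ln r => x1024 /andP[D1 Dx].
have x0 : 0 < x by lra.
have lx1 : 1 <= ln x.
  apply: (@le_trans _ _ (ln 4)); first by have := ln4_gt1 R; lra.
  by rewrite ler_ln ?posrE//; lra.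
have lx0 : 0 < ln x by lra.
have [k k0 /andP[Dk kD]] := @pow2_between R (72 * D) ltac:(lra).
have q16 : 1 <= x / (16 * ln x).
  by rewrite ler_pdivlMr ?mulr_gt0// mul1r ln_le_sixteenth.
have /andP[Jle ltJ] := truncn_itv (le_trans ler01 q16).
set J := Num.truncn _ in Jle ltJ.
have J0 : (0 < J)%N.
  by rewrite lt0n; apply: contraTneq ltJ => ->; rewrite -leNgt.
have J1 : 1 <= J%:R :> R by rewrite ler1n.
exists k, J; split => //; last first.
  have -> : x / ln x = 16 * (x / (16 * ln x)) by field; rewrite gt_eqF.
  by move: ltJ; rewrite -[J.+1%:R]natr1; lra.
have k2 : 0 < (2 ^ k)%:R :> R by rewrite ltr0n expn_gt0.
have Jx : 8 * (J%:R * ln x) <= x / 2.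
  by move: Jle; rewrite ler_pdivlMr ?mulr_gt0//; lra.
have l100 := @ln_le_sub1 R 100 ltac:(by []).
have lk : ln (2 ^ k)%:R <= 2 * ln x.
  have -> : 2 * ln x = ln (x * x) by rewrite lnM ?posrE// mulr_natl.
  rewrite ler_ln ?posrE ?mulr_gt0//; apply: (le_trans kD).
  apply: (@le_trans _ _ (144 * x)); first by lra.
  by rewrite ler_wpM2r ?(ltW x0)//; lra.
apply: (@le_trans _ _ (100 * (2 ^ k)%:R ^+ (4 * J))).
  rewrite -natrX -natrM ler_nat -mulnA leq_mul2l /=.
  have -> : ((2 ^ k) ^ (4 * J) = 2 ^ (k * 2 * J) * 2 ^ (k * 2 * J))%N.
    by rewrite -expnM -expnD; congr (_ ^ _)%N; ring.
  rewrite leq_mul2l ltnW ?orbT//; apply: leq_trans (ltn_expl J (ltnSn 1)) _.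
  by rewrite leq_exp2l// leq_pmull// muln_gt0 k0.
rewrite -ler_ln ?posrE ?mulr_gt0 ?exprn_gt0// -/x.
rewrite lnM ?posrE ?exprn_gt0// lnXn// -[ln _ *+ _]mulr_natl natrM.
have : 4 * J%:R * ln (2 ^ k)%:R <= 4 * J%:R * (2 * ln x).
  by rewrite ler_wpM2l.
by move: l100 Jx x1024; clear; lra.
Qed.

Lemma powR_root_le (R : realType) (p q c y : R) :
  1 <= p -> 0 <= q -> 1 <= c -> 0 <= y -> q <= c * y `^ p ->
  q `^ p^-1 <= c * y.
Proof.
move=> p1 q0 c1 y0 qy; have p0 : 0 < p by apply: lt_le_trans p1.
have c0 : 0 <= c by apply: le_trans c1.
have -> : c * y = ((c * y) `^ p) `^ p^-1.
  by rewrite -powRrM divff ?gt_eqF// powRr1// mulr_ge0.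
rewrite ge0_ler_powR ?nnegrE ?powR_ge0 ?invr_ge0 ?(ltW p0)//.
apply: (le_trans qy); rewrite powRM// ler_wpM2r ?powR_ge0//.
by rewrite -[leLHS]powRr1// ler_powR.
Qed.

(** Counting scales is needed only when ln r is large and D < ln r.  Otherwise
    the quotient ln r / ln (ln r), which is at most 13 ln r, is itself below
    the bound, since K and D are at least 1. *)
Lemma log_ratio_le (R : realType) (p r D K : R) :
  4 <= r -> 2 <= p -> 1 <= D -> 1 <= K ->
  (forall k J : nat, 72 * D <= (2 ^ k)%:R -> (0 < J)%N ->
    (100 * 2 ^ (k * 2 * J) * J)%:R <= r ->
    J%:R <= 12 * (16 * (K * D)) `^ p) ->
  (ln r / ln (ln r)) `^ p^-1 <= 20000 * (K * D).
Proof.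
move=> r4 p2 D1 K1 count.
have KD1 : 1 <= K * D by rewrite mulr_ege1.
have p1 : 1 <= p by apply: le_trans p2; rewrite ler1n.
have r0 : 0 < r by apply: lt_le_trans r4.
set x := ln r.
have x1 : 13 / 12 <= x by apply: le_trans (ln4_gt1 R) _; rewrite ler_ln ?posrE.
have x0 : 0 < x by lra.
have lx_ge : 13^-1 <= ln x.
  have xV : x^-1 <= 12 / 13 by rewrite -[12 / 13]invf_div lef_pV2 ?posrE//; lra.
  by have := ln_ge_1subV x0; lra.
have lx0 : 0 < ln x by lra.
set q := x / ln x.
have q1 : 1 <= q by rewrite ler_pdivlMr// mul1r; have := ln_le_sub1 x0; lra.
have q0 : 0 <= q by lra.
have qp : q `^ p^-1 <= q.
  rewrite -[leRHS]powRr1//; apply: ler_powR => //.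
  by rewrite invf_le1// (lt_le_trans _ p1).
have q13 : q <= 13 * x.
  rewrite ler_pdivrMr// -mulrA mulrCA ler_peMr//; first exact: ltW.
  by lra.
have [xs|/ltW xl] := leP x 1024; first by lra.
have [xD|/ltW Dx] := leP x D.
  have : D <= K * D by rewrite ler_peMl// (le_trans _ D1).
  by lra.
have [k [J [Dk J0 fits qJ]]] := scales_fit r0 xl (introT andP (conj D1 Dx)).
have {fits} := count k J Dk J0 fits.
set y := 16 * (K * D) => Jy.
have -> : 20000 * (K * D) = 1250 * y by rewrite /y; lra.
have y0 : 0 <= y by rewrite mulr_ge0// (le_trans _ KD1).
apply: (le_trans (powR_root_le (c := 384) p1 q0 _ y0 _)).
- by rewrite ler1n.
- by move: qJ Jy; rewrite -/x -/q; clear; lra.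
- by rewrite ler_wpM2r// ler_nat.
Qed.

Lemma distortion_ge (R : realType) (p : R) (X : normedModType R) (r D : R) :
  2 <= p -> 4 <= r -> 1 <= D ->
  (exists f : heis -> X, forall x y, heis_ball r x -> heis_ball r y ->
    (dW x y)%:R <= `|f x - f y| <= D * (dW x y)%:R) ->
  forall K : R, 0 < K -> convexity_ineq p X K ->
  (ln r / ln (ln r)) `^ p^-1 <= 20000 * (K * D).
Proof.
move=> p2 r4 D1 [f fD] K K0 cvx.
have K1 := convexity_ge1 p2 (embedding_target_nonzero fD r4) K0 cvx.
apply: log_ratio_le => // k J Dk J0 fits.
exact: embedding_scale_count fD _ _ _ _ p2 K1 cvx Dk J0 fits.
Qed.

Theorem theorem1p3 (R : realType) :
  exists2 kappa : R, 0 < kappa &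
    forall (p : R) (X : completeNormedModType R),
      2 <= p ->
      (exists2 K : R, 0 < K & convexity_ineq p X K) ->
      forall r : R, 4 <= r ->
        (kappa%:E / convexity_constant p X
           * ((ln r / ln (ln r)) `^ p^-1)%:E
         <= distortion (fun x y => (dW x y)%:R) (heis_ball r) X)%E.
Proof.
have [c c_gt0 cE] : exists2 c : R, 0 < c & c = 20000 by exists 20000; lra.
exists c^-1 => [|p X p2 [K0 K0_gt0 cvx0] r r4]; first by rewrite invr_gt0.
set S := (ln r / ln (ln r)) `^ p^-1.
apply: le_ereal_inf_tmp => _ [D [D1 fD] <-].
have D_gt0 : 0 < D by apply: lt_le_trans D1.
have S_le K : 0 < K -> convexity_ineq p X K -> S <= c * (K * D).
  by rewrite cE; exact: distortion_ge fD K.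
have cD_gt0 : 0 < c * D by rewrite mulr_gt0.
have S_gt0 : 0 < S.
  have l1 : 1 < ln r.
    apply: (@lt_le_trans _ _ (ln 4)); first by have := ln4_gt1 R; lra.
    by rewrite ler_ln ?posrE// (lt_le_trans _ r4).
  apply: powR_gt0; apply: divr_gt0; last exact: ln_gt0.
  exact: lt_trans ltr01 l1.
have lower : ((S / (c * D))%:E <= convexity_constant p X)%E.
  apply: le_ereal_inf_tmp => _ [K [K_gt0 cvx] <-].
  by rewrite lee_fin ler_pdivrMr// mulrCA; exact: S_le.
have upper : (convexity_constant p X <= K0%:E)%E.
  by apply: ereal_inf_lbound; exists K0.
case: (convexity_constant p X) lower upper => [k||]; rewrite ?lee_fin//.
move=> lower _.
have k_gt0 : 0 < k by apply: lt_le_trans lower; rewrite divr_gt0.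
rewrite inver gt_eqF// -!EFinM lee_fin.
move: lower; rewrite ler_pdivrMr// => lower.
rewrite -invfM mulrC ler_pdivrMr ?mulr_gt0//.
by rewrite [leRHS](_ : _ = k * (c * D))//; ring.
Qed.
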